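(* There exist positive constants $c_2$ and $x_2$ such that for every $x>x_2$, $$\mathcal N_B(x) \gg e^{e^{c_2(\ln\ln\ln x)^2}}.$$
   Context: A Nov\'ak number is a positive integer $N$ such that $N$ divides $2^N+1$. For real $x$, $\mathcal N_B(x)$ denotes the number of Nov\'ak numbers $N\le x$. *)

(* Defs.v *)
From mathcomp Require Import all_boot all_order all_algebra.
From mathcomp Require Import all_classical all_reals all_analysis.
Set Implicit Arguments.
Unset Strict Implicit.
Unset Printing Implicit Defensive.
Import Order.TTheory GRing.Theory Num.Theory.
Local Open Scope ring_scope.

Definition novak (N : nat) : bool := ((0 < N) && (N %| 2 ^ N + 1))%N.

(* The index type 'I_(truncn x).+1 only makes the set visibly finite: every
   natural number N with N%:R <= x lies in it. *)
Definition novak_count (R : realType) (x : R) : nat :=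
  #|[pred N : 'I_(Num.truncn x).+1 | novak N && ((N : nat)%:R <= x)]|.

Lemma novak_count_range (R : realType) (x : R) (N : nat) :
  N%:R <= x -> (N < (Num.truncn x).+1)%N.
Proof.
by move=> Nx; rewrite ltnS truncn_ge_nat // (le_trans (ler0n R N) Nx).
Qed.

(* Main.v *)
Require Import Defs.
From mathcomp Require Import all_boot all_order all_algebra.
From mathcomp Require Import all_classical all_reals all_analysis.
From mathcomp Require Import zify ring lra.
Import Order.TTheory GRing.Theory Num.Theory.

(** If [N] is a Novák number and [p] divides [2 ^ N + 1], then [N * p] is a Novák
    number. Starting from a power of 3 and adjoining primes [p j] that divide
    [2 ^ 3 ^ (j + 2) + 1] primitively, one gets, with [e = 3 ^ n], the Novák number
    [N = 3 ^ e * \prod_(j < n - 2) p j ^ e], which is at most [2 ^ e ^ 3] and has at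
    least [3 ^ (n * (n - 2))] divisors [d] divisible by [3 ^ e]. Each [2 ^ d + 1] has
    a primitive prime factor: the reciprocals of the primes dividing [d] sum to less
    than 1, so the non-primitive part of [2 ^ d + 1] is too small. These primes are
    distinct and divide [2 ^ N + 1], hence [N] times any subproduct of them is a
    Novák number, which is at most [N * (2 ^ N + 1)]. *)

Set Implicit Arguments.
Unset Strict Implicit.
Unset Printing Implicit Defensive.

Local Open Scope nat_scope.

(** * Divisors of [x ^ m + 1] for odd [m] *)

(** Binomial expansion of [x = (x + 1) - 1], where the binomial coefficient of [2 * m + 1] over 2 is
    [m * (2 * m + 1)]. The explicit linear term fixes [S] modulo [(x + 1) ^ 2], which the valuation
    bound requires. *)
Lemma odd_expn_add1 (x m : nat) : exists2 S : nat,
  x ^ (2 * m + 1) + 1 = (x + 1) * S &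
  exists t : int, (S%:Z = (2 * m + 1)%:Z * (1 - m%:Z * (x + 1)%:Z)
                          + (x + 1)%:Z ^+ 2 * t)%R.
Proof.
elim: m => [|m [S eS [t et]]].
  by exists 1; [rewrite expn1 muln1 | exists 0%R; rewrite mulr0; lia].
have [S' eS'] : exists S' : nat, x ^ (2 * m.+1 + 1) + 1 = (x + 1) * S'.
  exists (x ^ (2 * m + 1) * x + S - x ^ (2 * m + 1)).
  have -> : 2 * m.+1 + 1 = (2 * m + 1).+2 by lia.
  rewrite !expnS; move: (x ^ (2 * m + 1)) eS => X eS.
  have : X <= X * x + S by case: x {et} eS => [|x] eS; nia.
  by move=> le; rewrite mulnBr mulnDr -eS; nia.
exists S' => //.
(* Obtained from [S' = x ^ 2 * S - (x - 1)] by writing [x ^ 2] and [x - 1] in powers of [x + 1]. *)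
exists ((1 - 2%:Z * (x + 1)%:Z + (x + 1)%:Z ^+ 2) * t
        + 2%:Z * m%:Z * (2 * m + 1)%:Z + (2 * m + 1)%:Z
        - m%:Z * (2 * m + 1)%:Z * (x + 1)%:Z)%R.
apply: (@mulfI _ (x + 1)%:Z%R); first by lia.
rewrite -(PoszM (x + 1) S') -eS'.
have -> : (2 * m.+1 + 1) = (2 * m + 1).+2 by lia.
rewrite !expnS PoszD !PoszM.
have -> : (x ^ (2 * m + 1))%:Z%R = ((x + 1)%:Z * S%:Z - 1)%R.
  by rewrite -(PoszM (x + 1) S) -eS PoszD addrK.
rewrite et.
have -> : ((2 * m + 1).+2%:Z = 2%:Z * m%:Z + 3%:Z)%R by lia.
have -> : ((2 * m + 1)%:Z = 2%:Z * m%:Z + 1)%R by lia.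
have -> : (m.+1%:Z = m%:Z + 1)%R by lia.
have -> : ((x + 1)%:Z = x%:Z + 1)%R by lia.
ring.
Qed.

Lemma dvdn_expn_odd_add1 (x m : nat) : odd m -> x + 1 %| x ^ m + 1.
Proof.
move=> om; have -> : m = 2 * m./2 + 1 by lia.
by have [S -> _] := odd_expn_add1 x m./2; apply: dvdn_mulr.
Qed.

Lemma dvdn_exp2_odd_mul (q a b : nat) :
  odd b -> a %| b -> q %| 2 ^ a + 1 -> q %| 2 ^ b + 1.
Proof.
move=> ob /dvdnP[c eb] /dvdn_trans; apply.
by rewrite eb mulnC expnM dvdn_expn_odd_add1 //; move: ob; rewrite eb oddM => /andP[].
Qed.

Lemma dvdn_exp2_add1_odd (q d : nat) : 0 < d -> q %| 2 ^ d + 1 -> odd q.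
Proof.
by move=> d0 /dvdn_odd; apply; rewrite oddD oddX; case: d d0.
Qed.

(* The half of lifting the exponent that bounds the valuation from above. *)
Lemma logn_expn_prime_add1 (q r x : nat) : prime q -> prime r -> odd r ->
  q %| x + 1 -> logn q (x ^ r + 1) <= logn q (r * (x + 1)).
Proof.
move=> pq pr or qx.
have er : r = 2 * r./2 + 1 by lia.
have [S eS [t]] := odd_expn_add1 x r./2; rewrite -er in eS * => et.
have r0 := prime_gt0 pr.
have S0 : 0 < S by case: S eS {et} => //; lia.
rewrite eS !lognM ?addn1 // addnC leq_add2r.
(* When [q = r], [q ^ 2] divides [(x + 1) ^ 2], so [q ^ 2 %| S] would force [q] to divide
   [1 - r./2 * (x + 1)], hence 1. *)
have qS2 : ~~ (q * q %| S) || (q != r).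
  have [eqr|] := eqVneq q r; rewrite ?orbT ?orbF //; apply/negP => h.
  have : ((q%:Z * q%:Z)%R %| (q%:Z * (1 - r./2%:Z * (x + 1)%:Z))%R)%Z.
    have -> : (q%:Z * (1 - r./2%:Z * (x + 1)%:Z) = S%:Z - (x + 1)%:Z ^+ 2 * t)%R.
      by rewrite et eqr; ring.
    have h' : ((q * q)%:Z %| S%:Z)%Z := h; rewrite PoszM in h'.
    by rewrite rpredB // dvdz_mulr // expr2 dvdz_mul.
  rewrite dvdz_mul2l; last by have := prime_gt0 pq; lia.
  rewrite rpredBr; last by rewrite dvdz_mull.
  by rewrite dvdz1 /= => /eqP q1; rewrite q1 in pq.
have qSr : q %| S -> q = r.
  move=> qS; apply/eqP; rewrite -dvdn_prime2 //.
  suff : (q%:Z %| r%:Z)%Z by [].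
  have -> : (r%:Z = S%:Z - (x + 1)%:Z * ((x + 1)%:Z * t - r%:Z * r./2%:Z))%R.
    by rewrite et; ring.
  by rewrite rpredB // dvdz_mulr.
have [qS|nqS] := boolP (q %| S); last first.
  by have -> : logn q S = 0 by rewrite lognE (negbTE nqS) !andbF.
have eqr := qSr qS; rewrite -eqr eqxx orbF in qS2.
by rewrite -eqr (logn_prime q pq) eqxx /= leqNgt -pfactor_dvdn.
Qed.

Lemma dvdn_from_logn (a b : nat) : 0 < a -> 0 < b ->
  (forall q, prime q -> q %| a -> logn q a <= logn q b) -> a %| b.
Proof.
move=> a0 b0 h; apply/dvdn_partP => // q; rewrite mem_primes => /and3P[pq _ qa].
by rewrite p_part pfactor_dvdn // h.
Qed.

(** * Primitive prime factors of [2 ^ d + 1] *)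

(** For odd [d], testing the maximal proper divisors [d %/ r] covers every proper divisor [a], since
    [2 ^ a + 1] divides some [2 ^ (d %/ r) + 1]. *)
Definition primitive_prime (d q : nat) : Prop :=
  [/\ prime q, q %| 2 ^ d + 1 &
      forall r, prime r -> r %| d -> ~~ (q %| 2 ^ (d %/ r) + 1)].

(* If every prime factor of [2 ^ d + 1] divided some [2 ^ (d %/ r) + 1], then
   by lifting the exponent [2 ^ d + 1] would divide the product on the left. *)
Lemma primitive_prime_exists (d : nat) (s : seq nat) :
  odd d -> {subset primes d <= s} -> (forall r, r \in s -> 0 < r) ->
  \prod_(r <- s) (r * (2 ^ (d %/ r) + 1)) < 2 ^ d + 1 ->
  exists q, primitive_prime d q.
Proof.
move=> od ds s0; rewrite ltnNge => /negP lt; apply: contrapT => nq; apply: lt.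
have P0 : 0 < \prod_(r <- s) (r * (2 ^ (d %/ r) + 1)).
  rewrite big_seq; apply: prodn_cond_gt0 => r rs.
  by rewrite muln_gt0 s0 //= addn1.
apply: dvdn_leq => //; apply: dvdn_from_logn => //; first by rewrite addn1.
move=> q pq qd.
have [r [pr rd qr]] : exists r, [/\ prime r, r %| d & q %| 2 ^ (d %/ r) + 1].
  apply: contrapT => nr; apply: nq; exists q; split => // r pr rd.
  by apply/negP => qr; apply: nr; exists r.
have d0 : 0 < d by case: d od {ds rd nq qd qr P0}.
have rs : r \in s by apply: ds; rewrite mem_primes pr d0.
apply: (@leq_trans (logn q (r * (2 ^ (d %/ r) + 1)))).
  rewrite -{1}(divnK rd) expnM logn_expn_prime_add1 //.
  exact: dvdn_odd rd od.
apply: dvdn_leq_log => //.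
by rewrite (big_rem r) //= dvdn_mulr.
Qed.

Lemma expn_gcd_mod (x q a b : nat) : 0 < a -> 
  x ^ a = 1 %[mod q] -> x ^ b = 1 %[mod q] -> x ^ gcdn a b = 1 %[mod q].
Proof.
move=> a0 ha hb; case: (egcdnP b a0) => u v e _.
have hX c k : x ^ c = 1 %[mod q] -> x ^ (k * c) = 1 %[mod q].
  by move=> h; rewrite mulnC expnM -modnXm h modnXm exp1n.
by rewrite -(hX _ u ha) e expnD -modnMml (hX _ v hb) modnMml mul1n.
Qed.

Lemma exp2_double_mod (q d : nat) : q %| 2 ^ d + 1 -> 2 ^ (d * 2) = 1 %[mod q].
Proof.
move=> qd; apply/eqP; rewrite eqn_mod_dvd ?expn_gt0 // expnM.
by rewrite -[X in _ - X](exp1n 2) subn_sqr dvdn_mull.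
Qed.

(** With [h = gcdn a d], [2 ^ (2 * h)] is 1 modulo [q]. As [d] is an odd multiple of [h], [2 ^ h]
    agrees with [2 ^ d], that is, with -1; primitivity then forces [h = d]. *)
Lemma primitive_prime_dvdn (d q a : nat) : odd d -> 0 < a -> primitive_prime d q ->
  2 ^ a = 1 %[mod q] -> d %| a.
Proof.
move=> od a0 [pq qd prim] ha.
have d0 : 0 < d by case: d od {qd prim}.
set h := gcdn a d.
have hd : h %| d := dvdn_gcdr a d.
have h0 : 0 < h by rewrite gcdn_gt0 a0.
have h2 : 2 ^ (2 * h) = 1 %[mod q].
  have h2d : 2 ^ (2 * d) = 1 %[mod q].
    by rewrite mulnC; apply: exp2_double_mod.
  have g2 := expn_gcd_mod a0 ha h2d.
  have /dvdnP[k ->] : gcdn a (2 * d) %| 2 * h.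
    by rewrite muln_gcdr dvdn_gcd dvdn_gcdr andbT dvdn_mull // dvdn_gcdl.
  by rewrite mulnC expnM -modnXm g2 modnXm exp1n.
have qh : q %| 2 ^ h + 1.
  have e : d = 2 * h * (d %/ h)./2 + h.
    have oc : odd (d %/ h) by apply: dvdn_odd od; apply: dvdn_div.
    have := divnK hd; move: (d %/ h) oc => c oc.
    have -> : c * h = 2 * h * c./2 + h; last by [].
    have ec : c = c./2 * 2 + 1 by lia.
    by rewrite {1}ec; ring.
  have : 2 ^ d = 2 ^ h %[mod q].
    by rewrite {1}e expnD expnM -modnMml -modnXm h2 modnXm exp1n modnMml mul1n.
  move=> em; move: qd; rewrite /dvdn -modnDml em modnDml //.
have [->|hltd] := eqVneq d h; first exact: dvdn_gcdl.
have dh1 : 1 < d %/ h.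
  by rewrite ltn_divRL // mul1n ltn_neqAle eq_sym hltd dvdn_leq.
have := prim _ (pdiv_prime dh1).
have rdh := pdiv_dvd (d %/ h).
have rd : pdiv (d %/ h) %| d by apply: dvdn_trans rdh _; apply: dvdn_div.
move/(_ rd)/negP; case.
apply: dvdn_exp2_odd_mul qh.
  by apply: dvdn_odd od; apply: dvdn_div.
have [k ek] := dvdnP rdh.
apply/dvdnP; exists k; move: (pdiv_gt0 (d %/ h)) ek.
by move: (pdiv (d %/ h)) => r r0 ek; rewrite -{1}(divnK hd) ek mulnAC mulnK.
Qed.

Lemma primitive_prime_inj (d d' q : nat) : odd d -> odd d' ->
  primitive_prime d q -> primitive_prime d' q -> d = d'.
Proof.
suff H a b : odd a -> odd b -> primitive_prime a q -> primitive_prime b q -> a %| b.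
  by move=> o o' p p'; apply/eqP; rewrite eqn_dvd !H.
move=> oa ob pa [_ qb _].
have : a %| b * 2.
  apply: primitive_prime_dvdn pa _ => //; first by case: b ob {qb} => //=; lia.
  exact: exp2_double_mod.
by rewrite Gauss_dvdl // coprimen2.
Qed.

Lemma primitive_prime_gt (d q : nat) : odd d -> primitive_prime d q -> d < q.
Proof.
move=> od pdq; have [pq qd _] := pdq.
have oq : odd q by apply: dvdn_exp2_add1_odd qd; case: d od {pdq}.
have q1 := prime_gt1 pq.
(* Fermat's little theorem gives [2 ^ q.-1 = 1] modulo [q]. *)
suff : d %| q.-1 by move/dvdn_leq; lia.
apply: primitive_prime_dvdn pdq _ => //; first by lia.
have /eqP := fermat_little 2 pq.
rewrite !eqn_mod_dvd //; last by rewrite -{1}(expn1 2) leq_exp2l //; lia.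
have -> : 2 ^ q - 2 = 2 * (2 ^ q.-1 - 1).
  by rewrite mulnBr -expnS prednK // ltnW.
rewrite Gauss_dvdr ?coprimen2 //.
by rewrite -eqn_mod_dvd ?expn_gt0 // => /eqP.
Qed.

(** * Closure properties of Novák numbers *)

Lemma novak_odd (N : nat) : novak N -> odd N.
Proof. by case/andP=> N0; apply: dvdn_exp2_add1_odd. Qed.

(** The cofactor of [2 ^ N + 1] in [2 ^ (N * p) + 1] is [p] times an integer plus a multiple of
    [2 ^ N + 1], so [p] divides it, while [N] divides [2 ^ N + 1]. *)
Lemma novak_mul_dvd (N p : nat) : novak N -> p %| 2 ^ N + 1 -> novak (N * p).
Proof.
case/andP=> N0 NN pN.
have op := dvdn_exp2_add1_odd N0 pN.
have ep : p = 2 * p./2 + 1 by lia.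
have p0 : 0 < p by lia.
rewrite /novak muln_gt0 N0 p0 /= expnM.
have [S eS [t]] := odd_expn_add1 (2 ^ N) p./2; rewrite -ep in eS * => et.
rewrite eS dvdn_mul //.
suff : (p%:Z %| S%:Z)%Z by [].
rewrite et rpredD // dvdz_mulr // expr2 dvdz_mulr //.
Qed.

(** Quantifying over all Novák multiples of [N] lets factors be adjoined one after another. *)
Definition novak_factor (N M : nat) : Prop :=
  forall N', N %| N' -> novak N' -> novak (N' * M).

Lemma novak_factor1 (N : nat) : novak_factor N 1.
Proof. by move=> N' _; rewrite muln1. Qed.

Lemma novak_factorM (N A B : nat) :
  novak_factor N A -> novak_factor N B -> novak_factor N (A * B).
Proof.
by move=> a b N' NN' n; rewrite mulnA; apply: b (a _ NN' n); apply: dvdn_mulr.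
Qed.

Lemma novak_factorX (N A e : nat) : novak_factor N A -> novak_factor N (A ^ e).
Proof.
move=> a; elim: e => [|e IH]; first exact: novak_factor1.
by rewrite expnS; apply: novak_factorM.
Qed.

Lemma novak_factor_dvd (N p : nat) : p %| 2 ^ N + 1 -> novak_factor N p.
Proof.
move=> pN N' NN' n; apply: novak_mul_dvd => //.
by apply: dvdn_exp2_odd_mul pN => //; apply: novak_odd.
Qed.

Lemma novak_factor_prod (I : Type) (s : seq I) (P : pred I) (N : nat) (F : I -> nat) :
  (forall i, P i -> novak_factor N (F i)) -> novak_factor N (\prod_(i <- s | P i) F i).
Proof.
move=> h; apply: big_ind => //; first exact: novak_factor1.
exact: novak_factorM.
Qed.

(** * Counting Novák numbers by subsets of primitive primes *)

Lemma card_novak_ge (R : realType) (x : R) (N : nat) (I : finType) (d q : I -> nat) :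
  novak N -> injective d -> (forall i, d i %| N) ->
  (forall i, primitive_prime (d i) (q i)) ->
  ((N * (2 ^ N + 1))%:R <= x)%R -> 2 ^ #|I| <= novak_count x.
Proof.
move=> nN dinj dN dq Nx.
have oN := novak_odd nN.
have od i : odd (d i) := dvdn_odd (dN i) oN.
have qp i : prime (q i) by case: (dq i).
have qinj : injective q.
  move=> i j e; apply: dinj; apply: (@primitive_prime_inj _ _ (q i)) => //.
  by rewrite e.
have N0 : 0 < N by case/andP: nN.
have qN i : q i %| 2 ^ N + 1.
  by case: (dq i) => _ h _; apply: dvdn_exp2_odd_mul h.
have dvdq (T : {set I}) i : (q i %| \prod_(j in T) q j) = (i \in T).
  rewrite Euclid_dvd_prod // big_has_cond; apply/hasP/idP.
    by case=> j _ /andP[jT]; rewrite dvdn_prime2 // => /eqP/qinj ->.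
  by move=> iT; exists i; rewrite ?mem_index_enum //= iT dvdnn.
have prod0 (P : pred I) : 0 < \prod_(i | P i) q i.
  by apply: prodn_cond_gt0 => i _; apply: prime_gt0.
(* The [q j] are distinct primes, so each has valuation 1 in the product. *)
have prodN (T : {set I}) : \prod_(j in T) q j %| 2 ^ N + 1.
  apply: dvdn_from_logn; rewrite ?prod0 ?addn1 //.
  move=> p pp; rewrite Euclid_dvd_prod // big_has_cond => /hasP[j _ /andP[jT]].
  rewrite dvdn_prime2 // => /eqP ->.
  rewrite (bigD1 j) //= lognM ?prod0 ?prime_gt0 //.
  rewrite logn_prime // eqxx /=.
  rewrite (_ : logn _ (\prod_(_ | _) _) = 0); last first.
    rewrite lognE (_ : (_ %| _) = false) ?andbF //.
    apply/negbTE; rewrite Euclid_dvd_prod // big_has_cond; apply/negP.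
    case/hasP=> i _ /andP[/andP[_ ij]]; rewrite dvdn_prime2 // => /eqP/qinj e.
    by rewrite e eqxx in ij.
  by rewrite addn0 -pfactor_dvdn // expn1 -addn1.
pose F (T : {set I}) := N * \prod_(j in T) q j.
have Fx T : ((F T)%:R <= x)%R.
  apply: le_trans Nx; rewrite ler_nat leq_mul2l (dvdn_leq _ (prodN T)) ?orbT //.
  by rewrite addn1.
pose f (T : {set I}) : 'I_(Num.truncn x).+1 := inord (F T).
have fE T : f T = F T :> nat by rewrite inordK // novak_count_range.
have finj : injective f.
  (* A subset is recovered from its product as the set of [i] with [q i] dividing it. *)
  move=> A B /(congr1 (fun i : 'I__ => nat_of_ord i)); rewrite !fE => /eqP.
  rewrite eqn_pmul2l // => /eqP e; apply/setP => i.
  by rewrite -!dvdq e.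
rewrite -[#|I|]cardsT -card_powerset -(card_imset _ finj).
apply: subset_leq_card; apply/fintype.subsetP => _ /imsetP[T _ ->].
rewrite inE /= fE Fx andbT.
apply: novak_factor_prod (dvdnn N) nN => i _; exact: novak_factor_dvd.
Qed.

(** * A Novák number with many divisors *)

(** Geometric series with floors; keeping the last term on the left makes the induction
    telescope. *)
Lemma sum_divn_exp3 (d k : nat) :
  2 * (\sum_(j < k) d %/ 3 ^ (j + 2)) + d %/ 3 ^ (k + 1) <= d %/ 3.
Proof.
elim: k => [|k IH]; first by rewrite big_ord0.
rewrite big_ord_recr /= mulnDr.
have : 3 * (d %/ 3 ^ (k + 2)) <= d %/ 3 ^ (k + 1).
  by rewrite [k + 2]addnS expnSr divnMA mulnC leq_trunc_div.
have -> : k.+1 + 1 = k + 2 by lia.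
move: IH; move: (d %/ 3 ^ (k + 2)) (d %/ 3 ^ (k + 1)) (d %/ 3) => a b c.
by move: (\sum_(i < k) _) => s; lia.
Qed.

(** Exponents start at 2 because [2 ^ 3 + 1 = 9] has no primitive prime factor. With
    [X = 2 ^ 3 ^ (j + 1)], at least 8, the criterion reads [3 * (X + 1) < X ^ 3 + 1]. *)
Lemma primitive_prime_pow3 (j : nat) : exists q, primitive_prime (3 ^ (j + 2)) q.
Proof.
apply: (@primitive_prime_exists _ [:: 3]).
- by rewrite oddX orbT.
- by move=> r; rewrite addnS primesX // primes_prime.
- by move=> r; rewrite inE => /eqP ->.
have -> : j + 2 = (j + 1).+1 by lia.
rewrite big_seq1 expnS mulKn // [X in _ < 2 ^ X + 1]mulnC expnM.
have : 2 ^ 3 <= 2 ^ 3 ^ (j + 1) by rewrite leq_exp2l // addn1 expnS leq_pmulr // expn_gt0.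
by move: (2 ^ 3 ^ (j + 1)) => X; rewrite !expnS expn0; nia.
Qed.

Lemma primitive_prime_pow3_le (j n q : nat) : j + 2 < n ->
  primitive_prime (3 ^ (j + 2)) q -> q <= 2 ^ 3 ^ n.
Proof.
move=> jn [_ qd _]; apply: leq_trans (dvdn_leq _ qd) _; first by rewrite addn1.
have : 2 ^ (3 ^ (j + 2)).+1 <= 2 ^ 3 ^ n.
  by rewrite leq_exp2l // ltn_exp2l.
by rewrite expnS; have := expn_gt0 2 (3 ^ (j + 2)); lia.
Qed.

(* The factors attached to the [p j] contribute a geometric series in the
   exponent because [p j > 3 ^ (j + 2)]. *)
Lemma primitive_prime_exists_smooth (k e d : nat) (p : nat -> nat) :
  (forall j, primitive_prime (3 ^ (j + 2)) (p j)) ->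
  (forall j, j < k -> p j <= 2 ^ e) -> k.+1 < e -> 3 <= e ->
  odd d -> 3 ^ e %| d -> {subset primes d <= 3 :: [seq p j | j <- iota 0 k]} ->
  exists q, primitive_prime d q.
Proof.
move=> pp ple ke e3 od ed ds.
have p0 j : 0 < p j by apply: prime_gt0; case: (pp j).
apply: (primitive_prime_exists od ds).
  by move=> r; rewrite inE => /predU1P[-> //|/mapP[j _ ->]].
rewrite big_cons big_map -[k]subn0 -/(index_iota 0 k) big_mkord.
have d0 : 0 < d by case: d od {ed ds}.
have ded : 3 ^ e <= d by apply: dvdn_leq.
have le1 : 3 * (2 ^ (d %/ 3) + 1) <= 2 ^ (d %/ 3 + 3).
  by rewrite expnD; have := expn_gt0 2 (d %/ 3); lia.
have le2 : \prod_(j < k) (p j * (2 ^ (d %/ p j) + 1))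
    <= 2 ^ (\sum_(j < k) (e.+1 + d %/ 3 ^ (j + 2))).
  rewrite expn_sum; apply: leq_prod => j _.
  rewrite addSnnS expnD leq_mul ?ple //.
  apply: (@leq_trans (2 ^ (d %/ 3 ^ (j + 2)) + 1)).
    rewrite leq_add2r leq_exp2l // leq_div2l ?expn_gt0 //.
    apply: ltnW; apply: primitive_prime_gt => //.
    by rewrite oddX orbT.
  by rewrite expnS; have := expn_gt0 2 (d %/ 3 ^ (j + 2)); lia.
(* The terms [d %/ 3 ^ i] total at most [d / 2]; the rest, [k * e.+1 + 3], is at most [e ^ 2], and
   [2 * e ^ 2 <= 3 ^ e <= d]. *)
have le3 : d %/ 3 + 3 + \sum_(j < k) (e.+1 + d %/ 3 ^ (j + 2)) <= d.
  rewrite big_split /= sum_nat_const card_ord.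
  have := sum_divn_exp3 d k; move: (\sum_(j < k) _) => S.
  have : 2 * e * e <= d.
    apply: leq_trans ded; elim: e e3 {ple ke ed le2} => // e IH.
    rewrite leq_eqVlt => /predU1P[<- //|e3].
    by rewrite expnS; have := IH e3; nia.
  have : k * e.+1 + 3 <= e * e by nia.
  have : d %/ 3 * 3 <= d := leq_trunc_div d 3.
  move: (k * e.+1) (d %/ 3) (d %/ 3 ^ (k + 1)) => u v w.
  by lia.
rewrite [X in _ < X]addn1 ltnS; apply: leq_trans (leq_mul le1 le2) _.
by rewrite -expnD leq_exp2l.
Qed.

Lemma novak_exp3 (e : nat) : novak (3 ^ e).
Proof.
by have := @novak_factorX 1 3 e (@novak_factor_dvd 1 3 isT) 1 (dvdnn 1) isT; rewrite mul1n.
Qed.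

Lemma novak_count_tower (R : realType) (x : R) (n : nat) : 2 <= n ->
  ((2 ^ (2 ^ 3 ^ (4 * n)))%:R <= x)%R -> 2 ^ 3 ^ (n * (n - 2)) <= novak_count x.
Proof.
move=> n2 lex.
have [p pp] := choice primitive_prime_pow3.
set k := n - 2; set e := 3 ^ n.
have pj j : prime (p j) by case: (pp j).
have e9 : 9 <= e by rewrite -[9]/(3 ^ 2) leq_exp2l.
have ne : n < e by apply: ltn_expl.
have ple j : j < k -> p j <= 2 ^ e.
  by move=> jk; apply: primitive_prime_pow3_le (pp j); lia.
have podd j : odd (3 ^ (j + 2)) by rewrite oddX orbT.
have pgt3 j : 3 < p j.
  apply: leq_trans (@primitive_prime_gt _ _ (podd j) (pp j)).
  by rewrite addn2 !expnS; have := expn_gt0 3 j; lia.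
have pinj i j : p i = p j -> i = j.
  move=> eij; have := pp j; rewrite -eij => pij.
  have /eqP := @primitive_prime_inj _ _ _ (podd i) (podd j) (pp i) pij.
  by rewrite eqn_exp2l // eqn_add2r => /eqP.
pose N := 3 ^ e * \prod_(j < k) p j ^ e.
have nN : novak N.
  apply: (@novak_factor_prod _ _ _ (3 ^ e)) => //; last exact: novak_exp3.
  move=> j _; apply: novak_factorX; apply: novak_factor_dvd.
  case: (pp j) => _ h _; apply: dvdn_exp2_odd_mul h; first by rewrite oddX orbT.
  by rewrite dvdn_Pexp2l //; have := ltn_ord j; lia.
(* One divisor for each choice of exponents below [e]: there are [e ^ k] of them, told apart by
   their valuations at the [p j]. *)
pose d (b : {ffun 'I_k -> 'I_e}) := 3 ^ e * \prod_(j < k) p j ^ b j.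
have dN b : d b %| N.
  rewrite dvdn_mul //; apply: (big_ind2 (fun x y => x %| y)) => //.
    by move=> *; apply: dvdn_mul.
  by move=> j _; rewrite dvdn_exp2l // ltnW.
have prodgt0 (b : {ffun 'I_k -> 'I_e}) (P : pred 'I_k) : 0 < \prod_(j < k | P j) p j ^ b j.
  by apply: prodn_cond_gt0 => j _; rewrite expn_gt0 prime_gt0.
have logd b (j : 'I_k) : logn (p j) (d b) = b j.
  rewrite lognM ?prodgt0 ?expn_gt0 // lognX logn_prime //.
  have /negbTE -> : p j != 3 by have := pgt3 j; lia.
  rewrite muln0 add0n (bigD1 j) //= lognM ?prodgt0 ?expn_gt0 ?prime_gt0 //.
  rewrite lognX logn_prime // eqxx muln1 [X in _ + X = _](_ : _ = 0) ?addn0 //.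
  rewrite lognE (_ : (_ %| _) = false) ?andbF //.
  apply/negbTE; rewrite Euclid_dvd_prod // big_has_cond; apply/negP.
  case/hasP=> i _ /andP[ij]; rewrite Euclid_dvdX // dvdn_prime2 //.
  by case/andP=> /eqP/pinj/val_inj eij; rewrite eij eqxx in ij.
have dinj : injective d.
  by move=> b c eb; apply/ffunP => j; apply/val_inj; rewrite /= -!logd eb.
have dprim b : exists q, primitive_prime (d b) q.
  apply: (@primitive_prime_exists_smooth k e _ p) => //.
  - by lia.
  - by lia.
  - exact: dvdn_odd (dN b) (novak_odd nN).
  - by rewrite dvdn_mulr.
  move=> r; rewrite mem_primes => /and3P[pr _]; rewrite Euclid_dvdM // => /orP[].
    by rewrite Euclid_dvdX // dvdn_prime2 // inE => /andP[->].
  rewrite Euclid_dvd_prod // big_has_cond => /hasP[j _] /=.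
  rewrite Euclid_dvdX // dvdn_prime2 // => /andP[/eqP -> _].
  by rewrite inE map_f ?orbT // mem_iota /=.
have [q dq] := choice dprim.
have -> : 3 ^ (n * k) = #|{ffun 'I_k -> 'I_e}| by rewrite card_ffun !card_ord expnM.
apply: (card_novak_ge nN dinj dN dq).
apply: le_trans lex; rewrite ler_nat.
(* The exponent is at most [2 * e + e ^ 2 * (n - 2)], and [n < e]. *)
have Nle : N <= 2 ^ (e ^ 3).
  have h : N <= 2 ^ (2 * e) * 2 ^ (e * e * k).
    apply: leq_mul; first by rewrite expnM leq_exp2r //; lia.
    apply: (@leq_trans (\prod_(j < k) 2 ^ (e * e))).
      by apply: leq_prod => j _; rewrite expnM leq_exp2r ?ple //; lia.
    by rewrite prod_nat_const card_ord -expnM.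
  apply: leq_trans h _; rewrite -expnD leq_exp2l // !expnS expn0 /k.
  by nia.
have N2 : N * (2 ^ N + 1) <= 2 ^ (3 * N).
  have hN : N < 2 ^ N by apply: ltn_expl.
  have -> : 2 ^ (3 * N) = 2 ^ N * (2 ^ N * 2 ^ N) by rewrite -!expnD; congr (2 ^ _); lia.
  apply: leq_mul; first exact: ltnW.
  have : 0 < N by case/andP: nN.
  by nia.
apply: leq_trans N2 _; rewrite leq_exp2l //.
apply: (@leq_trans (2 ^ (2 + e ^ 3))).
  by rewrite expnD leq_mul.
rewrite leq_exp2l // mulnC expnM -/e [e ^ 4]expnS.
have : 1 < e ^ 3 by rewrite -[1]/(2 ^ 0) (leq_trans _ (_ : 2 ^ 3 <= _)) ?leq_exp2r //; lia.
by nia.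
Qed.

Local Open Scope ring_scope.

(** * Passage to real exponentials and logarithms *)

(** Rests on [a = 1 + (a - 1) <= expR (a - 1)] for positive [a]. *)
Lemma natr_expn_le_expR (R : realType) (a m : nat) (y : R) :
  m%:R * a.-1%:R <= y -> (a ^ m)%:R <= expR y.
Proof.
move=> my; apply: le_trans (_ : expR (m%:R * a.-1%:R) <= _); last by rewrite ler_expR.
rewrite expRM_natl natrX lerXn2r ?nnegrE ?ler0n ?expR_ge0 //.
apply: le_trans (expR_ge1Dx _); rewrite nat1r ler_nat; lia.
Qed.

Lemma expR_half_le_natr_expn (R : realType) (a m : nat) :
  (2 <= a)%N -> expR (m%:R / 2 : R) <= (a ^ m)%:R.
Proof.
move=> a2; rewrite expRM_natl natrX lerXn2r ?nnegrE ?ler0n ?expR_ge0 //.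
apply: le_trans (_ : 2 <= _); last by rewrite ler_nat.
rewrite -[2^-1]opprK expRN invf_ple ?posrE ?expR_gt0 //.
by apply: le_trans (expR_ge1Dx _); lra.
Qed.

Theorem theorem1 (R : realType) :
  exists c2 x2 : R, 0 < c2 /\ 0 < x2 /\
    exists K : R, 0 < K /\
      forall x : R, x2 < x ->
        K * expR (expR (c2 * (ln (ln (ln x))) ^+ 2)) <= (novak_count x)%:R.
Proof.
(* The threshold makes the triple logarithm [L] exceed 32, so that [n], the floor of [L / 8], is at
   least 4. The constant 1/1000 is small enough that [L < 8 * (n + 1)] gives
   [c2 * L ^ 2 + 1 <= n * (n - 2) / 2]. *)
exists (1 / 1000), (expR (expR (expR 32))); split; first by lra.
split; first exact: expR_gt0.
exists 1; split => // x hx; rewrite mul1r.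
have ln_gt (a y : R) : expR a < y -> a < ln y /\ y = expR (ln y).
  move=> ay; have y0 : 0 < y := lt_trans (expR_gt0 a) ay.
  by rewrite lnK ?posrE // -ltr_expR lnK.
have [hx1 ex1] := ln_gt _ _ hx.
have [hx2 ex2] := ln_gt _ _ hx1.
have [hL ex3] := ln_gt _ _ hx2.
move: hL ex3; set L := ln _ => hL ex3.
have L0 : 0 <= L / 8 by lra.
have /andP[] := truncn_itv L0; set n := Num.truncn _ => nL Ln.
have n4 : (4 <= n)%N by rewrite -ltnS -(ltr_nat R) (lt_trans _ Ln) //; lra.
(* The divisor 8 in [n] enters here: [3 ^ (4 * n) <= expR (8 * n) <= expR L]. *)
have tower : (2 ^ (2 ^ 3 ^ (4 * n)))%:R <= x.
  rewrite ex1 natr_expn_le_expR //= mulr1 ex2 natr_expn_le_expR //= mulr1 ex3.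
  by rewrite natr_expn_le_expR //= natrM; lra.
have := novak_count_tower (leq_trans _ n4) tower => /(_ isT).
rewrite -(ler_nat R); apply: le_trans.
apply: le_trans (expR_half_le_natr_expn R _ (leqnn 2)).
rewrite ler_expR.
have h : expR ((n * (n - 2))%:R / 2 : R) <= (3 ^ (n * (n - 2)))%:R.
  exact: expR_half_le_natr_expn.
apply: le_trans (_ : expR ((n * (n - 2))%:R / 2) / 2 <= _); last first.
  by rewrite ler_pM2r // invr_gt0.
rewrite ler_pdivlMr // {h tower}.
(* The factor 2 left by halving the outer exponent is absorbed as [+ 1] in the inner one. *)
have e1 : 2 <= expR (1 : R) by apply: le_trans (expR_ge1Dx _); lra.
apply: le_trans (ler_wpM2l (expR_ge0 _) e1) _.
rewrite -expRD ler_expR natrM natrB; last by lia.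
have n4r : 4 <= n%:R :> R by rewrite (ler_nat R 4).
rewrite -[n.+1%:R]natr1 in Ln.
move: Ln n4r hL; move: (n%:R : R) (L) => a l la a4 l32.
have l2 : l ^+ 2 <= (8 * (a + 1)) ^+ 2.
  by apply: lerXn2r; rewrite ?nnegrE; lra.
nra.
Qed.
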